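(* Let $\mathbb A=\{a<b\}$ be a two-letter ordered alphabet and let $w$ be a cyclic word over $\mathbb A$. The following are equivalent: (1) $w$ is singular; (2) $w$ is balanced; (3) $w$ is a Christoffel word.
   Context: Words: $\mathbb A^+$ (resp. $\mathbb A^*$) is the set of non-empty (resp. all) finite words over $\mathbb A$. For $x=x_1\cdots x_n$ put $x^*=x_n\cdots x_1$. A cyclic word over $\mathbb A$ is an equivalence class of $\mathbb A^+$ under $w\sim w'$ iff $w=pq$, $w'=qp$ for some $p,q\in\mathbb A^*$; the elements of the class are its linear representations, and ''$w=uv$'' means that $uv$ is a linear representation of $w$. A factor of a cyclic word is a factor (contiguous subword) of one of its linear representations. $|u|_a$ is the number of occurrences of the letter $a$ in $u$. Order (for words of equal length): if $x\ne y$ have equal length and $i$ is the first index with $x_i\neq y_i$, then $x\prec y$ iff $x_i<y_i$. Singular: $w$ is singular if for every factorization $w=uv$ with $u,v\in\mathbb A^+$, $u\neq u^*$, $v\neq v^*$ one has ($u\prec u^*\iff v\prec v^*$). Balanced: $w$ is balanced if for all factors $u$ and $v$ of $w$ of equal length one has $\bigl||u|_a-|v|_a\bigr|\le1$. Christoffel: the numbers of occurrences of $a$ and $b$ are not required to be coprime. For integers $p,q\ge0$ with $n=p+q\geq1$, the Christoffel word with $p$ occurrences of $a$ and $q$ occurrences of $b$ is $x_1\cdots x_n$ with $x_i=b$ if $\lfloor iq/n\rfloor>\lfloor (i-1)q/n\rfloor$ and $x_i=a$ otherwise (when $p,q$ are not coprime this is a power of a Christoffel word with coprime parameters). A cyclic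 word is called a Christoffel word if it is represented by such a linear word. *)

(* Defs.v *)
From mathcomp Require Import all_boot all_order all_algebra.
Set Implicit Arguments.
Unset Strict Implicit.
Unset Printing Implicit Defensive.
Import Order.TTheory GRing.Theory Num.Theory.

Definition conjugate (A : Type) (w w' : seq A) : Prop :=
  exists p q : seq A, w = p ++ q /\ w' = q ++ p.

(* A cyclic word is given by its class: [linrep C w] says that [w] is one of
   the linear representations of [C]. *)
Record cyclic_word (A : Type) := CyclicWord {
  linrep : seq A -> Prop;
  linrep_class :
    exists2 w : seq A, w <> [::] & forall w' : seq A, linrep w' <-> conjugate w w'
}.

Definition cyclic_factor (A : eqType) (C : cyclic_word A) (u : seq A) : Prop :=
  exists2 w : seq A, linrep C w & infix u w.

(* Here [p] is the longest common prefix of [x] and [y], so [c] and [d] are the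
   letters at the first index where the two words differ. *)
Definition prec (d0 : Order.disp_t) (A : orderType d0) (x y : seq A) : Prop :=
  size x = size y /\
  exists (p : seq A) (c d : A) (s t : seq A),
    [/\ x = p ++ c :: s, y = p ++ d :: t & (c < d)%O].

Definition singular (d0 : Order.disp_t) (A : orderType d0) (C : cyclic_word A) :
    Prop :=
  forall u v : seq A,
    linrep C (u ++ v) -> u <> [::] -> v <> [::] ->
    u <> rev u -> v <> rev v ->
    (prec u (rev u) <-> prec v (rev v)).

Definition balanced (A : eqType) (a : A) (C : cyclic_word A) : Prop :=
  forall u v : seq A,
    cyclic_factor C u -> cyclic_factor C v -> size u = size v ->
    (`|(count_mem a u)%:Z - (count_mem a v)%:Z| <= 1)%R.

Definition christoffel_word (A : Type) (a b : A) (p q : nat) : seq A :=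
  [seq if i.-1 * q %/ (p + q) < i * q %/ (p + q) then b else a
     | i <- iota 1 (p + q)].

Definition christoffel (A : Type) (a b : A) (C : cyclic_word A) : Prop :=
  exists p q : nat, 1 <= p + q /\ linrep C (christoffel_word a b p q).

(* Main.v *)
(* If w = uv with u = p a s, u^* = p b t and v = q b s', v^* = q a t', then
   a q^* p a and b p^* q b are factors of w, so that w is not balanced.
   Conversely, unbalanced factors of minimal length have the form a p a and
   b p b with p a palindrome; these do not overlap, and cutting w = apa z bpb z'
   before the last letter of apa and after the first letter of bpb contradicts
   singularity.
   In a balanced word of length n with q letters b, the windows of length k
   contain on average kq/n letters b, hence each contains at least the floor of
   kq/n; reading from the point where the path is highest above the line of
   slope q/n makes this an equality for prefixes, which is the Christoffel
   word. *)
Require Import Defs.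
From mathcomp Require Import all_boot all_order all_algebra.
From mathcomp Require Import zify.

Set Implicit Arguments.
Unset Strict Implicit.
Unset Printing Implicit Defensive.

(** * Cyclic words as windows of a periodic sequence *)

Definition window (A : Type) (x : nat -> A) (i k : nat) : seq A :=
  [seq x l | l <- iota i k].

Definition unroll (A : Type) (a : A) (w : seq A) (i : nat) : A :=
  nth a w (i %% size w).

Lemma size_window (A : Type) (x : nat -> A) i k : size (window x i k) = k.
Proof. by rewrite size_map size_iota. Qed.

Lemma window_cat (A : Type) (x : nat -> A) i k m :
  window x i (k + m) = window x i k ++ window x (i + k) m.
Proof. by rewrite /window iotaD map_cat. Qed.

Lemma nth_window (A : Type) (c : A) (x : nat -> A) i k l :
  l < k -> nth c (window x i k) l = x (i + l).
Proof. by move=> ltlk; rewrite (nth_map 0) ?size_iota // nth_iota. Qed.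

Lemma window_modn (A : Type) (a : A) (w : seq A) i j k :
  i = j %[mod size w] -> window (unroll a w) i k = window (unroll a w) j k.
Proof.
move=> eqij; apply: (@eq_from_nth _ a) => [|l]; rewrite !size_window // => ltlk.
by rewrite !nth_window // /unroll -(modnDml i) eqij modnDml.
Qed.

Lemma window_unroll (A : Type) (a : A) (w : seq A) :
  window (unroll a w) 0 (size w) = w.
Proof.
apply: (@eq_from_nth _ a) => [|l]; rewrite size_window // => ltlw.
by rewrite nth_window // /unroll modn_small.
Qed.

(** Moving a prefix [p] to the end means reading the periodic extension from index [size p];
    conversely a start [i] can be reduced modulo [size w]. *)
Lemma conjugate_window (A : Type) (a : A) (w w' : seq A) : 0 < size w ->
  conjugate w w' <-> exists i, w' = window (unroll a w) i (size w).
Proof.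
move=> w_gt0; split=> [[p [q [def_w ->]]]|[i ->]].
  exists (size p).
  have szw : size w = size p + size q by rewrite def_w size_cat.
  have := window_unroll a w.
  rewrite szw window_cat [X in _ = X -> _]def_w add0n => eqw.
  have eqp : window (unroll a w) 0 (size p) = p.
    by have := congr1 (take (size p)) eqw; rewrite !take_size_cat ?size_window.
  have eqq : window (unroll a w) (size p) (size q) = q.
    by have := congr1 (drop (size p)) eqw; rewrite !drop_size_cat ?size_window.
  rewrite (addnC (size p) (size q)) window_cat eqq -szw.
  by rewrite (@window_modn _ a w _ 0) ?eqp // modnn mod0n.
set n := size w; set r := i %% n.
have ltrn : r < n by rewrite ltn_mod.
exists (window (unroll a w) 0 r), (window (unroll a w) r (n - r)).
split.
  by rewrite -[X in window _ X (n - r)]add0n -window_cat subnKC ?window_unroll // ltnW.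
rewrite (@window_modn _ a w i r) ?modn_mod //.
rewrite -{1}(subnK (ltnW ltrn)) window_cat subnKC; last exact: ltnW.
by rewrite (@window_modn _ a w n 0) ?modnn ?mod0n.
Qed.

Lemma linrep_size_gt0 (A : Type) (C : cyclic_word A) w :
  linrep C w -> 0 < size w.
Proof.
have [w0 w0N linC] := linrep_class C.
move=> /linC[p [q [def_w0 ->]]]; rewrite size_cat addnC -size_cat -def_w0.
by case: w0 w0N {linC def_w0}.
Qed.

Lemma conjugate_size (A : Type) (w w' : seq A) :
  conjugate w w' -> size w' = size w.
Proof. by move=> [p [q [-> ->]]]; rewrite !size_cat addnC. Qed.

(** Through windows two rotations are shifts that add up, which avoids a case analysis on the
    relative position of the two cuts. *)
Lemma conjugate_trans (A : Type) (w1 w2 w3 : seq A) :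
  conjugate w1 w2 -> conjugate w2 w3 -> conjugate w1 w3.
Proof.
move=> conj12 conj23.
have sz2 := conjugate_size conj12; have sz3 := conjugate_size conj23.
case: w1 => [|c w1] in conj12 sz2 *.
  exists [::], [::]; split=> //; apply: size0nil; by rewrite sz3 sz2.
have w1_gt0 : 0 < size (c :: w1) by [].
have w2_gt0 : 0 < size w2 by rewrite sz2.
have /(conjugate_window c _ w1_gt0)[i def_w2] := conj12.
have /(conjugate_window c _ w2_gt0)[j ->] := conj23.
apply/(conjugate_window c _ w1_gt0); exists (i + j); rewrite sz2.
apply: (@eq_from_nth _ c) => [|l]; rewrite !size_window // => ltl.
rewrite !nth_window // {1}/unroll {1}def_w2 sz2 nth_window ?ltn_mod //.
by rewrite /unroll modnDmr addnA.
Qed.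

(** The record supplies a single base word; symmetry and transitivity of conjugacy let any
    representation take its place. *)
Lemma linrep_conjugate (A : Type) (C : cyclic_word A) w : linrep C w ->
  forall w', linrep C w' <-> conjugate w w'.
Proof.
have [w0 _ linC] := linrep_class C.
move=> /linC conj0w w'; rewrite linC; split; last exact: conjugate_trans.
apply: conjugate_trans; case: conj0w => p [q [-> ->]].
by exists q, p.
Qed.

Lemma linrep_window (A : Type) (a : A) (C : cyclic_word A) w : linrep C w ->
  forall w', linrep C w' <-> exists i, w' = window (unroll a w) i (size w).
Proof.
move=> Cw w'; rewrite (linrep_conjugate Cw).
exact/conjugate_window/(linrep_size_gt0 Cw).
Qed.

Lemma cyclic_factor_window (A : eqType) (a : A) (C : cyclic_word A) w u :
    linrep C w ->
  cyclic_factor C u <->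
  exists i, exists2 k, k <= size w & u = window (unroll a w) i k.
Proof.
move=> Cw; split=> [[w' /(linrep_window a Cw)[i ->]]|[i [k lekw ->]]].
  move=> /infixP[s [t eq_st]].
  have szw : size w = size s + (size u + size t).
    by rewrite -(size_window (unroll a w) i (size w)) eq_st !size_cat.
  exists (i + size s), (size u); first by lia.
  move: eq_st; rewrite szw !window_cat.
  move/(congr1 (take (size u) \o drop (size s))) => /=.
  by rewrite !drop_size_cat ?size_window // !take_size_cat ?size_window.
exists (window (unroll a w) i (size w)).
  by apply/(linrep_window a Cw); exists i.
by rewrite -(subnKC lekw) window_cat; apply: prefixW; apply: prefix_prefix.
Qed.

(** * Letter counts in windows, and balance *)

Definition weight (A : eqType) (b : A) (x : nat -> A) i k :=
  count_mem b (window x i k).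

Lemma weight_add (A : eqType) (b : A) x i k m :
  weight b x i (k + m) = weight b x i k + weight b x (i + k) m.
Proof. by rewrite /weight window_cat count_cat. Qed.

Lemma weight1 (A : eqType) (b : A) x i : weight b x i 1 = (x i == b).
Proof. exact: addn0. Qed.

Lemma weight_le (A : eqType) (b : A) x i k : weight b x i k <= k.
Proof. by rewrite /weight -[leqRHS](size_window x i) count_size. Qed.

(** One-sided, since exchanging [i] and [j] gives the other inequality. *)
Definition weight_balanced (A : eqType) (b : A) (x : nat -> A) k :=
  forall i j, weight b x i k <= (weight b x j k).+1.

Lemma count_two_letters (A : eqType) (a b : A) (u : seq A) :
  a != b -> (forall c : A, c = a \/ c = b) ->
  count_mem a u + count_mem b u = size u.
Proof.
move=> neq_ab Aab; elim: u => //= c u IHu.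
case: (Aab c) => ->; rewrite eqxx 1?[b == a]eq_sym (negPf neq_ab); lia.
Qed.

(** In windows of equal length the counts of [a] and [b] are complementary, so their differences
    agree up to sign. *)
Lemma balanced_weight (A : eqType) (a b : A) (C : cyclic_word A) w :
    a != b -> (forall c : A, c = a \/ c = b) -> linrep C w ->
  balanced a C <->
  forall k, k <= size w -> weight_balanced b (unroll a w) k.
Proof.
move=> neq_ab Aab Cw.
have count_a i k : count_mem a (window (unroll a w) i k)
                 = k - weight b (unroll a w) i k.
  have := count_two_letters (window (unroll a w) i k) neq_ab Aab.
  rewrite size_window /weight; lia.
split=> [bal k lekw i j|bal u v].
  have cf i' : cyclic_factor C (window (unroll a w) i' k).
    by apply/(cyclic_factor_window a _ Cw); exists i', k.
  have := bal _ _ (cf i) (cf j); rewrite !size_window !count_a => /(_ erefl).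
  have := weight_le b (unroll a w) i k.
  have := weight_le b (unroll a w) j k; lia.
move=> /(cyclic_factor_window a _ Cw)[i [k lekw ->]].
move=> /(cyclic_factor_window a _ Cw)[j [k' _ ->]].
rewrite !size_window => <-; rewrite !count_a.
have := bal k lekw i j; have := bal k lekw j i.
have := weight_le b (unroll a w) i k.
have := weight_le b (unroll a w) j k; lia.
Qed.

(** * Comparison with the reversal; balance implies singularity *)

Lemma precP (d0 : Order.disp_t) (A : orderType d0) (c : A) (x y : seq A) :
  size x = size y ->
  prec x y <-> exists m, [/\ m < size x,
    forall l, l < m -> nth c x l = nth c y l & (nth c x m < nth c y m)%O].
Proof.
move=> eq_sz; split=> [[_ [p [e [f [s [t [-> -> ltef]]]]]]]|[m [ltmx eq_xy lt_xy]]].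
  exists (size p); split=> [|l ltlp|]; first by rewrite size_cat /=; lia.
    by rewrite !nth_cat ltlp.
  by rewrite !nth_cat ltnn subnn.
split=> //.
exists (take m x), (nth c x m), (nth c y m), (drop m.+1 x), (drop m.+1 y).
split=> //; first by rewrite -drop_nth // cat_take_drop.
have -> : take m x = take m y.
  apply: (@eq_from_nth _ c) => [|l]; first by rewrite !size_take eq_sz.
  by rewrite size_take ltmx => ltlm; rewrite !nth_take ?eq_xy.
by rewrite -drop_nth -?eq_sz // cat_take_drop.
Qed.

Lemma prec_asym (d0 : Order.disp_t) (A : orderType d0) (x y : seq A) :
  prec x y -> ~ prec y x.
Proof.
case: x => [|c x] lt_xy; first by case: lt_xy => _ [[|? ?] [? [? [? [? []]]]]].
have [eq_sz _] := lt_xy.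
move: lt_xy => /(precP c eq_sz)[m [_ eqm ltm]].
move=> /(precP c (esym eq_sz))[m' [_ eqm' ltm']].
case: (ltngtP m m') ltm ltm' => [/eqm'->|/eqm->|<-]; rewrite ?Order.POrderTheory.ltxx //.
by move/Order.POrderTheory.lt_trans=> lt_tr /lt_tr; rewrite Order.POrderTheory.ltxx.
Qed.

Lemma prec_total (d0 : Order.disp_t) (A : orderType d0) (x y : seq A) :
  size x = size y -> x <> y -> prec x y \/ prec y x.
Proof.
elim: x y => [|c x IHx] [|d y] //= [eq_sz] neq_xy.
case: (Order.TotalTheory.ltgtP c d) => [ltcd|ltdc|eq_cd].
- by left; split=> /=; [rewrite eq_sz | exists [::], c, d, x, y].
- by right; split=> /=; [rewrite eq_sz | exists [::], d, c, y, x].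
rewrite {}eq_cd in neq_xy *.
have {}neq_xy : x <> y by move=> eq_xy; apply: neq_xy; rewrite eq_xy.
by case: (IHx y eq_sz neq_xy) => -[_ [p [e [f [s [t [def_x def_y ltef]]]]]]];
  [left|right]; (split; first by rewrite /= eq_sz);
  exists (d :: p), e, f, s, t; rewrite def_x def_y.
Qed.

Lemma infix_cyclic_factor (A : eqType) (C : cyclic_word A) (s u t : seq A) :
  linrep C (s ++ u ++ t) -> cyclic_factor C u.
Proof.
by move=> Cw; exists (s ++ u ++ t) => //; apply/infixP; exists s, t.
Qed.

Lemma balanced_prec (d0 : Order.disp_t) (A : orderType d0) (a b : A)
    (C : cyclic_word A) (u v : seq A) :
    (a < b)%O -> (forall c : A, c = a \/ c = b) ->
    balanced a C -> linrep C (u ++ v) ->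
  prec u (rev u) -> ~ prec (rev v) v.
Proof.
move=> ltab Aab bal Cuv [_ [p [c [d [s [t [def_u def_ru ltcd]]]]]]].
move=> [_ [q [c' [d' [s' [t' [def_rv def_v ltcd']]]]]]].
have ab_of e f : (e < f)%O -> e = a /\ f = b.
  case: (Aab e) (Aab f) => [->|->] [->|->] //; rewrite ?Order.POrderTheory.ltxx //.
  by move/Order.POrderTheory.lt_trans=> /(_ _ ltab); rewrite Order.POrderTheory.ltxx.
have [eqc eqd] := ab_of _ _ ltcd; have [eqc' eqd'] := ab_of _ _ ltcd'.
rewrite {}eqc {}eqd {}eqc' {}eqd' in def_u def_ru def_rv def_v.
have def_u' : u = rev t ++ b :: rev p.
  by rewrite -[u]revK def_ru rev_cat rev_cons cat_rcons.
have def_v' : v = rev s' ++ a :: rev q.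
  by rewrite -[v]revK def_rv rev_cat rev_cons cat_rcons.
have Cvu : linrep C (v ++ u) by apply/(linrep_conjugate Cuv); exists u, v.
(* The factor with ends [a] straddles the junction of [v ++ u], the one with ends [b] that of
   [u ++ v]. *)
have fac_a : cyclic_factor C (a :: rev q ++ p ++ [:: a]).
  apply: (@infix_cyclic_factor _ _ (rev s') _ s).
  by move: Cvu; rewrite def_v' {1}def_u /= -!catA.
have fac_b : cyclic_factor C (b :: rev p ++ q ++ [:: b]).
  apply: (@infix_cyclic_factor _ _ (rev t) _ t').
  by move: Cuv; rewrite def_u' {1}def_v /= -!catA.
(* Both inner words consist of [p] and [q] up to reversal, so the two counts of [a] differ by
   exactly two. *)
have := bal _ _ fac_a fac_b.
have neq_ba : (b == a) = false by rewrite Order.POrderTheory.gt_eqF.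
by rewrite /= !size_cat !count_cat !size_rev !count_rev /= eqxx neq_ba /=; lia.
Qed.

(** Applied to both rotations, [balanced_prec] excludes the two ways in which [u] and [v] could
    compare oppositely with their reversals. *)
Lemma balanced_singular (d0 : Order.disp_t) (A : orderType d0) (a b : A)
    (C : cyclic_word A) :
    (a < b)%O -> (forall c : A, c = a \/ c = b) ->
  balanced a C -> singular C.
Proof.
move=> ltab Aab bal u v Cuv _ _ upal vpal.
have Cvu : linrep C (v ++ u) by apply/(linrep_conjugate Cuv); exists u, v.
have noluv := balanced_prec ltab Aab bal Cuv.
have nolvu := balanced_prec ltab Aab bal Cvu.
have sz_rev (x : seq A) : size x = size (rev x) by rewrite size_rev.
have := prec_total (sz_rev u) upal; have := prec_total (sz_rev v) vpal; tauto.
Qed.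

(** * Letter counts in Christoffel words *)

Lemma nth_christoffel_word (A : Type) (c a b : A) p q l : l < p + q ->
  nth c (christoffel_word a b p q) l =
  if l * q %/ (p + q) < l.+1 * q %/ (p + q) then b else a.
Proof.
by move=> ltl; rewrite (nth_map 0) ?size_iota // nth_iota // add1n.
Qed.

Lemma size_christoffel_word (A : Type) (a b : A) p q :
  size (christoffel_word a b p q) = p + q.
Proof. by rewrite size_map size_iota. Qed.

(** Each letter [b] records a jump of the floor, so the counts telescope; this continues past one
    period because the floor gains [q] over each period. *)
Lemma weight_christoffel_word (A : eqType) (a b : A) p q i k :
    a != b -> 0 < p + q ->
  i * q %/ (p + q) + weight b (unroll a (christoffel_word a b p q)) i k
  = (i + k) * q %/ (p + q).
Proof.
move=> neq_ab n_gt0; elim: k => [|k IHk]; first by rewrite !addn0.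
rewrite -[k.+1]addn1 weight_add addnA {}IHk weight1 addnA addn1.
rewrite /unroll size_christoffel_word nth_christoffel_word ?ltn_mod //.
move: (i + k) => {k}i.
set n := p + q in n_gt0 *.
have step m : (i %/ n * n + m) * q %/ n = i %/ n * q + m * q %/ n.
  by rewrite mulnDl mulnAC divnMDl.
have -> : i * q %/ n = i %/ n * q + i %% n * q %/ n by rewrite -step -divn_eq.
have -> : i.+1 * q %/ n = i %/ n * q + (i %% n).+1 * q %/ n.
  by rewrite -step addnS -divn_eq.
have le_step : i %% n * q %/ n <= (i %% n).+1 * q %/ n.
  by rewrite leq_div2r // leq_mul2r leqnSn orbT.
(* As [q <= n], the floor jumps by at most one, so testing for a strict increase captures the whole
   jump. *)
have : (i %% n).+1 * q %/ n <= (i %% n * q %/ n).+1.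
  have -> : (i %% n * q %/ n).+1 = (i %% n * q + n) %/ n.
    by rewrite divnDr // divnn n_gt0 addn1.
  by rewrite leq_div2r // mulSn addnC leq_add2l leq_addl.
case: ltnP => [lt_step|ge_step]; rewrite ?eqxx ?(negPf neq_ab); lia.
Qed.

(** The floor of a sum is the sum of the floors plus a carry 0 or 1, and only the carry depends on
    the start of the window. *)
Lemma balanced_christoffel_word (A : eqType) (a b : A) p q k :
    a != b -> 0 < p + q ->
  weight_balanced b (unroll a (christoffel_word a b p q)) k.
Proof.
move=> neq_ab n_gt0 i j.
have := weight_christoffel_word i k neq_ab n_gt0.
have := weight_christoffel_word j k neq_ab n_gt0.
rewrite !mulnDl !(divnD _ (k * q) n_gt0); lia.
Qed.

(** * Average letter counts; balanced words and Christoffel words *)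

Lemma weight_size (A : eqType) (a b : A) (w : seq A) i :
  weight b (unroll a w) i (size w) = count_mem b w.
Proof.
elim: i => [|i IHi]; first by rewrite /weight window_unroll.
(* The [size w + 1] letters from [i] are split after the first and before the last; these two
   letters agree by periodicity. *)
have := weight_add b (unroll a w) i 1 (size w).
rewrite [1 + _]addnC weight_add {}IHi !weight1 addn1 /unroll modnDr addnC.
by move/addnI.
Qed.

Lemma weight_addl_size (A : eqType) (a b : A) (w : seq A) i k :
  weight b (unroll a w) (i + size w) k = weight b (unroll a w) i k.
Proof. by rewrite /weight (@window_modn _ a w _ i) // modnDr. Qed.

Lemma sum_weight1 (A : eqType) (b : A) x i n :
  \sum_(j < n) weight b x (j + i) 1 = weight b x i n.
Proof.
elim: n => [|n IHn]; first by rewrite big_ord0.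
by rewrite big_ord_recr /= IHn -[n.+1]addn1 weight_add [n + i]addnC.
Qed.

(** Lengthening all the windows by one letter adds each position of the cycle exactly once. *)
Lemma sum_weight (A : eqType) (a b : A) (w : seq A) k :
  \sum_(j < size w) weight b (unroll a w) j k = k * count_mem b w.
Proof.
elim: k => [|k IHk]; first by rewrite big1.
under eq_bigr => j _ do rewrite -[k.+1]addn1 weight_add.
by rewrite big_split /= IHk sum_weight1 weight_size mulSn addnC.
Qed.

(** If one window falls below the floor, balance keeps all others at most equal to it, and the total
    becomes too small for [sum_weight]. *)
Lemma weight_balanced_lower (A : eqType) (a b : A) (w : seq A) m k :
    0 < size w -> weight_balanced b (unroll a w) k ->
  k * count_mem b w %/ size w <= weight b (unroll a w) m k.
Proof.
move=> w_gt0 bal; rewrite leqNgt; apply/negP => ltW.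
have [r ltWr] : exists r : 'I_(size w),
    weight b (unroll a w) r k < k * count_mem b w %/ size w.
  exists (Ordinal (ltn_pmod m w_gt0)).
  by rewrite /weight (@window_modn _ a w _ m) // modn_mod.
have := sum_weight a b w k; rewrite (bigD1 r) //= => def_sum.
have le_sum : \sum_(j < size w | j != r) weight b (unroll a w) j k
            <= (size w).-1 * (k * count_mem b w %/ size w).
  have -> : (size w).-1 = #|predC1 r| by rewrite cardC1 card_ord.
  rewrite -sum_nat_const.
  by apply: leq_sum => j _; apply: leq_trans ltWr; apply: bal.
have := leq_divM (k * count_mem b w) (size w).
have : forall f, f * size w = f + (size w).-1 * f.
  by move=> f; rewrite -mulSn prednK // mulnC.
by move=> ->; move: def_sum le_sum ltWr; set S := bigop _ _ _; lia.
Qed.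

(* The start [m] maximizes the height of the path above the line of slope q/n,
   so that the path read from [m] stays below this line. *)
Lemma weight_upper (A : eqType) (a b : A) (w : seq A) : 0 < size w ->
  exists m, forall k, k <= size w ->
    weight b (unroll a w) m k <= k * count_mem b w %/ size w.
Proof.
move=> w_gt0; set n := size w; set q := count_mem b w; set x := unroll a w.
(* The height is scaled by [n] and raised by the constant [n * q], which keeps it a natural
   number. *)
pose height (m : 'I_n) := n * weight b x 0 m + (n - m) * q.
have [m _ max_m] := arg_maxnP height (erefl : predT (Ordinal w_gt0)).
exists m => k lekn; rewrite leq_divRL //.
have ltmn := ltn_ord m.
have split_mk := weight_add b x 0 m k.
case: (ltnP (m + k) n) => [ltmkn|lenmk].
  have := max_m (Ordinal ltmkn) erefl; rewrite /height /= split_mk add0n.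
  have -> : n - m = (n - (m + k)) + k by lia.
  by rewrite mulnDr mulnDl; lia.
(* Past the end of the period, the maximum is compared with the index reduced by [n]: a full turn
   raises the path and the line by [q] alike. *)
have ltr : m + k - n < n by lia.
have := max_m (Ordinal ltr) erefl; rewrite /height /=.
have : weight b x 0 (m + k) = q + weight b x 0 (m + k - n).
  rewrite -[m + k in LHS](subnKC lenmk) weight_add weight_size.
  by rewrite weight_addl_size.
rewrite split_mk add0n.
have -> : n - (m + k - n) = (n + n) - (m + k) by lia.
nia.
Qed.

Lemma balanced_christoffel (A : eqType) (a b : A) (C : cyclic_word A) :
    a != b -> (forall c : A, c = a \/ c = b) ->
  balanced a C -> christoffel a b C.
Proof.
move=> neq_ab Aab; have [w w0 linC] := linrep_class C.
have Cw : linrep C w by apply/linC; exists w, [::]; rewrite cats0.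
have w_gt0 := linrep_size_gt0 Cw.
move=> /(balanced_weight neq_ab Aab Cw) bal.
have [m upper] := weight_upper a b w_gt0.
set n := size w in w_gt0 bal upper; set q := count_mem b w in upper.
have leqn : q <= n := count_size _ _.
have def_weight k : k <= n -> weight b (unroll a w) m k = k * q %/ n.
  move=> lekn; apply/eqP; rewrite eqn_leq upper //=.
  exact/weight_balanced_lower/bal.
exists (n - q), q; rewrite subnK //; split=> //.
apply/(linrep_window a Cw); exists m.
apply: (@eq_from_nth _ a) => [|l];
  rewrite size_christoffel_word subnK ?size_window // => ltln.
rewrite nth_christoffel_word subnK // nth_window // -!def_weight ?(ltnW ltln) //.
(* The floors are now prefix weights, so the floor jumps exactly where the letter is [b]. *)
rewrite -[l.+1]addn1 weight_add weight1.
by case: (Aab (unroll a w (m + l))) => ->;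
  rewrite ?eqxx ?(negPf neq_ab) ?addn0 ?addn1 ?ltnn ?ltnSn.
Qed.

Lemma christoffel_balanced (A : eqType) (a b : A) (C : cyclic_word A) :
    a != b -> (forall c : A, c = a \/ c = b) ->
  christoffel a b C -> balanced a C.
Proof.
move=> neq_ab Aab [p [q [n_gt0 Cw]]].
by apply/(balanced_weight neq_ab Aab Cw) => k _; apply: balanced_christoffel_word.
Qed.

(** * Minimal unbalanced windows; singularity implies balance *)

(* For a minimal unbalanced length [k], the windows at [i] and [j] are [b p b]
   and [a p a] with [p] a palindrome. *)
Lemma minimal_unbalanced (A : eqType) (b : A) x i j k :
    (forall l, l < k -> weight_balanced b x l) ->
    (weight b x j k).+1 < weight b x i k ->
  [/\ forall l, 0 < l -> l < k -> weight b x i l = (weight b x j l).+1,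
      forall l, l <= k -> weight b x (i + (k - l)) l = weight b x i l &
      forall l, l <= k -> weight b x (j + (k - l)) l = weight b x j l].
Proof.
move=> bal gtWk.
have split_at y l : l <= k ->
    weight b x y k = weight b x y l + weight b x (y + l) (k - l).
  by move=> lelk; rewrite -weight_add subnKC.
(* Cutting after [l] letters splits a surplus of at least two into two parts, each at most one by
   minimality. *)
have diff l : 0 < l -> l < k -> weight b x i l = (weight b x j l).+1.
  move=> l_gt0 ltlk; have := split_at i l (ltnW ltlk).
  have := split_at j l (ltnW ltlk).
  have ltk : k - l < k by lia.
  by have := bal _ ltlk i j; have := bal _ ltk (i + l) (j + l); lia.
have diffk : 1 < k -> weight b x i k = (weight b x j k).+2.
  move=> k_gt1; have := split_at i 1 (ltnW k_gt1).
  have := split_at j 1 (ltnW k_gt1).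
  have := diff 1 erefl k_gt1.
  have ltk : k - 1 < k by lia.
  by have := bal _ ltk (i + 1) (j + 1); lia.
have k_gt1 : 1 < k by have := weight_le b x i k; lia.
(* Equal prefix and suffix counts at every length express that the window is a palindrome. *)
suff main l : 0 < l -> l < k ->
    weight b x (i + (k - l)) l = weight b x i l /\
    weight b x (j + (k - l)) l = weight b x j l.
  split=> // l; rewrite leq_eqVlt => /predU1P[->|ltlk];
    rewrite ?subnn ?addn0 //; case: (posnP l) => [->//|l_gt0];
    by case: (main l l_gt0 ltlk).
move=> l_gt0 ltlk; have ltk : k - l < k by lia.
have kl_gt0 : 0 < k - l by lia.
have := split_at i (k - l) (ltnW ltk); have := split_at j (k - l) (ltnW ltk).
rewrite subKn; last exact: ltnW.
have := diff _ l_gt0 ltlk; have := diff _ kl_gt0 ltk; have := diffk k_gt1.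
(* Comparing the prefix of each window with the suffix of the other pins both suffix counts. *)
have := bal _ ltlk i (j + (k - l)); have := bal _ ltlk (i + (k - l)) j.
lia.
Qed.

Lemma singular_weight_balanced (d0 : Order.disp_t) (A : orderType d0) (a b : A)
    (C : cyclic_word A) w :
    (a < b)%O -> (forall c : A, c = a \/ c = b) -> linrep C w -> singular C ->
  forall k, k <= size w -> weight_balanced b (unroll a w) k.
Proof.
move=> ltab Aab Cw sing k; elim/ltn_ind: k => k IHk lekn i j0.
set n := size w in lekn *; set x := unroll a w.
have n_gt0 : 0 < n := linrep_size_gt0 Cw.
have bal l : l < k -> weight_balanced b x l.
  by move=> ltlk; apply: IHk; lia.
rewrite leqNgt; apply/negP => gtWj0.
(* [j] represents [j0] modulo [n] between [i] and [i + n]; the term [i * n] prevents truncated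
   subtraction. *)
pose j := i + (j0 + i * n - i) %% n.
have eqWj l : weight b x j0 l = weight b x j l.
  rewrite /weight (@window_modn _ a w j0 j) //.
  have le_i : i <= j0 + i * n by nia.
  by rewrite /j modnDmr subnKC // addnC modnMDl.
have leij : i <= j := leq_addr _ _.
have ltjin : j < i + n by rewrite ltn_add2l ltn_mod.
have gtWj : (weight b x j k).+1 < weight b x i k by rewrite -eqWj.
clearbody j => {eqWj gtWj0 j0}.
have [diff refl_i refl_j] := minimal_unbalanced bal gtWj.
have k_gt1 : 1 < k by have := weight_le b x i k; lia.
have xab y : x y = if weight b x y 1 == 1 then b else a.
  have := Order.POrderTheory.lt_eqF ltab.
  by rewrite weight1; case: (Aab (x y)) => -> ; rewrite ?eqxx // => ->.
have Wi1 : weight b x i 1 = 1 /\ weight b x j 1 = 0.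
  by have := diff 1 erefl k_gt1; have := weight_le b x i 1; lia.
(* An overlap is a suffix of one window and a prefix of the other: reflection makes the two prefix
   weights of that length equal, while [diff] separates them by one. *)
have nolap1 : i + k <= j.
  rewrite leqNgt; apply/negP => ltjik.
  have ltij : i < j.
    by rewrite ltn_neqAle leij andbT; apply/eqP => eqij; move: Wi1; rewrite eqij; lia.
  have := refl_i (i + k - j); have := diff (i + k - j).
  have -> : i + (k - (i + k - j)) = j by lia.
  by move=> -> ; lia.
have nolap2 : j + k <= i + n.
  rewrite leqNgt; apply/negP => ltijk.
  have := refl_j (j + k - (i + n)); have := diff (j + k - (i + n)).
  have -> : j + (k - (j + k - (i + n))) = i + n by lia.
  by rewrite weight_addl_size => -> ; lia.
(* With [b p b] at [i] and [a p a] at [j], [u] reads [p b z a p] and [v] reads [a z' b]. *)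
pose u := window x i.+1 (j + k - 2 - i).
pose v := window x (j + k).-1 (i + n + 2 - (j + k)).
have su : size u = j + k - 2 - i by rewrite size_window.
have sv : size v = i + n + 2 - (j + k) by rewrite size_window.
have nth_u l : l < size u -> nth a u l = x (i.+1 + l).
  by rewrite su => ltl; rewrite nth_window.
have nth_v l : l < size v -> nth a v l = x ((j + k).-1 + l).
  by rewrite sv => ltl; rewrite nth_window.
have Cuv : linrep C (u ++ v).
  apply/(linrep_window a Cw); exists i.+1; rewrite /u /v.
  have -> : (j + k).-1 = i.+1 + (j + k - 2 - i) by lia.
  by rewrite -window_cat; congr window; lia.
have x_i : x i = b by rewrite xab; case: Wi1 => ->.
have x_j : x j = a by rewrite xab; case: Wi1 => _ ->.
have x_ik : x (i + k).-1 = b.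
  rewrite xab; have := refl_i 1 (ltnW k_gt1).
  by have -> : i + (k - 1) = (i + k).-1 by [lia]; case: Wi1 => -> _ ->.
have x_jk : x (j + k).-1 = a.
  rewrite xab; have := refl_j 1 (ltnW k_gt1).
  by have -> : j + (k - 1) = (j + k).-1 by [lia]; case: Wi1 => _ -> ->.
have lt_v : prec v (rev v).
  apply/(precP a); first by rewrite size_rev.
  exists 0; split=> //; first by lia.
  rewrite nth_rev ?nth_v; try lia.
  rewrite addn0 x_jk.
  have -> : (j + k).-1 + (size v - 1) = i + n by lia.
  by rewrite {1}/x /unroll modnDr -/(unroll a w i) -/x x_i.
have lt_u : prec (rev u) u.
  apply/(precP a); first by rewrite size_rev.
  (* [k - 2] is the length of the palindrome [p], with which both [u] and its reversal begin. *)
  exists (k - 2); rewrite size_rev su; split; first by lia.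
    move=> l ltl; rewrite nth_rev ?nth_u; try lia.
    rewrite !xab.
    have -> : i.+1 + (size u - l.+1) = j + (k - 2 - l) by lia.
    have -> : i.+1 + l = i + l.+1 by lia.
    (* Letters are increments of weights: [diff] at [t] and [t.+1] equates the letters at [j + t]
       and [i + t], and [refl_i] mirrors [i + t] to [i + l.+1]. *)
    set t := k - 2 - l; have ltt : 0 < t < k by lia.
    have := diff t; have := diff t.+1.
    have := weight_add b x j t 1; have := weight_add b x i t 1.
    have := weight_add b x (i + t) 1 l.+1; have := weight_add b x i l.+1 1.
    have := refl_i l.+1; have := refl_i l.+2.
    have -> : i + (k - l.+2) = i + t by lia.
    have -> : i + (k - l.+1) = i + t + 1 by lia.
    rewrite !add1n !addn1 => e1 e2 e3 e4 e5 e6 e7 e8.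
    suff -> : weight b x (j + t) 1 = weight b x (i + l.+1) 1 by [].
    by lia.
  rewrite nth_rev ?nth_u; try lia.
  have -> : i.+1 + (size u - (k - 2).+1) = j by lia.
  have -> : i.+1 + (k - 2) = (i + k).-1 by lia.
  by rewrite x_j x_ik.
have revN y : prec y (rev y) \/ prec (rev y) y -> y <> rev y.
  by move=> [] /[dup] lty + eqy; rewrite -eqy; move/prec_asym; rewrite -eqy in lty.
have [||||_ /(_ lt_v) gt_u] := sing u v Cuv.
- by move=> u0; move: su; rewrite u0 /=; lia.
- by move=> v0; move: sv; rewrite v0 /=; lia.
- by apply: revN; right.
- by apply: revN; left.
exact: prec_asym lt_u gt_u.
Qed.

(** * Closing the cycle of implications *)

Unset Implicit Arguments.

Theorem proposition4p4 (d0 : Order.disp_t) (A : orderType d0) (a b : A)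
    (ltab : (a < b)%O) (Aab : forall c : A, c = a \/ c = b)
    (w : cyclic_word A) :
  [<-> singular w; balanced a w; christoffel a b w].
Proof.
have neq_ab : a != b by rewrite Order.POrderTheory.lt_eqF.
tfae=> [sing|bal|chr].
- have [w0 _ linC] := linrep_class w.
  have Cw0 : linrep w w0 by apply/linC; exists w0, [::]; rewrite cats0.
  apply/(balanced_weight neq_ab Aab Cw0).
  exact: singular_weight_balanced ltab Aab Cw0 sing.
- exact: balanced_christoffel neq_ab Aab bal.
- apply: (balanced_singular ltab Aab).
  exact: christoffel_balanced neq_ab Aab chr.
Qed.
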